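(* Let $(M,J)$ be a connected complex manifold which is not of Kähler type, endowed with an LCK metric with fundamental form $\Omega$ and Lee form $\theta$ such that $$\Omega=-a\,dJ\theta+\theta\wedge aJ\theta$$ for some constant $a\in\mathbb{R}_{>0}$. If the Lee vector field $B$ of $(\Omega,\theta)$ is real holomorphic, i.e. $\mathcal{L}_BJ=0$, then $\Omega$ is Vaisman.
   Context: A complex manifold is of Kähler type if it admits a Kähler metric. A Hermitian metric $g$ on $(M,J)$ with fundamental form $\Omega=g(J\cdot,\cdot)$ is locally conformally Kähler (LCK) if there is a real closed one-form $\theta$ (the Lee form) with $d\Omega=\theta\wedge\Omega$. For a one-form $\alpha$ put $J\alpha=-\alpha\circ J$. The Lee vector field $B$ and anti-Lee vector field $A=JB$ are defined by $\iota_B\Omega=J\theta$, $\iota_A\Omega=-\theta$; equivalently $B$ is the $g$-dual of $\theta$. The metric is Vaisman if $\nabla^g\theta=0$, where $\nabla^g$ is the Levi-Civita connection of $g$. *)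

(* Defs.v *)
From HB Require Import structures.
From mathcomp Require Import all_boot all_order all_algebra.
From mathcomp Require Import all_classical all_reals all_analysis.

Set Implicit Arguments.
Unset Strict Implicit.
Unset Printing Implicit Defensive.

Import Order.TTheory GRing.Theory Num.Theory.
Import numFieldNormedType.Exports.

Local Open Scope classical_set_scope.
Local Open Scope ring_scope.

Section Calculus.
Context {R : realType} {V W : normedModType R}.

Fixpoint Ck (k : nat) (U : set V) (f : V -> W) : Prop :=
  if k is k'.+1 then
    (forall x, U x -> differentiable f x) /\ (forall v, Ck k' U ('D_v f))
  else forall x, U x -> {for x, continuous f}.

Definition smooth_on (U : set V) (f : V -> W) : Prop := forall k, Ck k U f.

End Calculus.

Section ComplexLinear.
Context {R : realType} {n : nat}.

(* C^n is R^(2n) through x + iy = (x, y), and J0 is multiplication by i. *)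
Definition J0 (v : 'rV[R]_(n + n)) : 'rV[R]_(n + n) :=
  row_mx (- rsubmx v) (lsubmx v).

(* Holomorphic map between open sets of C^n: real differentiable with a
   C-linear differential (the Cauchy-Riemann equations). *)
Definition holomorphic_on (U : set 'rV[R]_(n + n))
    (f : 'rV[R]_(n + n) -> 'rV[R]_(n + n)) : Prop :=
  forall x, U x ->
    differentiable f x /\ forall v, 'd f x (J0 v) = J0 ('d f x v).

Definition lie_bracket (X Y : 'rV[R]_(n + n) -> 'rV[R]_(n + n))
    (x : 'rV[R]_(n + n)) : 'rV[R]_(n + n) :=
  'D_(X x) Y x - 'D_(Y x) X x.

(* (L_X F) Y = [X, F Y] - F [X, Y] is tensorial in Y, so the vector v is
   extended to a constant local vector field. *)
Definition lie_endo (X : 'rV[R]_(n + n) -> 'rV[R]_(n + n))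
    (F : 'rV[R]_(n + n) -> 'rV[R]_(n + n) -> 'rV[R]_(n + n))
    (x v : 'rV[R]_(n + n)) : 'rV[R]_(n + n) :=
  lie_bracket X (fun y => F y v) x - F x (lie_bracket X (fun=> v) x).

End ComplexLinear.

(* Complex manifold of complex dimension n: a Hausdorff second countable
   space with a holomorphic atlas.  The coordinate map [coord i] and its
   inverse [param i] are total functions, meaningful only on the domain
   [dom i] and on its image [img i]. *)
Record complexManifold (R : realType) (n : nat) (M : topologicalType) := {
  chart : Type;
  dom : chart -> set M;
  img : chart -> set 'rV[R]_(n + n);
  coord : chart -> M -> 'rV[R]_(n + n);
  param : chart -> 'rV[R]_(n + n) -> M;
  manifold_hausdorff : hausdorff_space M;
  manifold_second_countable : @second_countable M;
  dom_open : forall i, open (dom i);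
  img_open : forall i, open (img i);
  dom_cover : forall p, exists i, dom i p;
  coord_img : forall i p, dom i p -> img i (coord i p);
  param_dom : forall i x, img i x -> dom i (param i x);
  coordK : forall i p, dom i p -> param i (coord i p) = p;
  paramK : forall i x, img i x -> coord i (param i x) = x;
  coord_continuous : forall i p, dom i p -> {for p, continuous (coord i)};
  param_continuous : forall i x, img i x -> {for x, continuous (param i)};
  transition_holomorphic : forall i j,
    holomorphic_on [set x | img i x /\ dom j (param i x)]
      (coord j \o param i)
}.

Section Tensors.
Context {R : realType} {n : nat} {M : topologicalType}.
Variable X : complexManifold R n M.

Local Notation E := 'rV[R]_(n + n).

Definition overlap (i j : chart X) : set E :=
  [set x | img i x /\ dom j (param i x)].

Definition transition (i j : chart X) : E -> E := coord j \o param i.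

(* A tensor field is given by its coordinate expression in every chart,
   evaluated on coordinate vectors; only its values over [img i] matter. *)
Definition vfield := chart X -> E -> E.
Definition form1 := chart X -> E -> E -> R.
Definition tensor2 := chart X -> E -> E -> E -> R.
Definition form3 := chart X -> E -> E -> E -> E -> R.

Definition is_vfield (B : vfield) : Prop :=
  (forall i, smooth_on (img i) (B i)) /\
  (forall i j x, overlap i j x ->
     B j (transition i j x) = 'd (transition i j) x (B i x)).

Definition is_form1 (al : form1) : Prop :=
  [/\ forall i x, img i x -> scalar (al i x),
      forall i v, smooth_on (img i) (fun x => al i x v) &
      forall i j x, overlap i j x -> forall v,
        al i x v = al j (transition i j x) ('d (transition i j) x v)].

Definition is_tensor2 (g : tensor2) : Prop :=
  [/\ forall i x, img i x -> forall u,
        scalar (g i x u) /\ scalar (fun v => g i x v u),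
      forall i u v, smooth_on (img i) (fun x => g i x u v) &
      forall i j x, overlap i j x -> forall u v,
        g i x u v = g j (transition i j x)
          ('d (transition i j) x u) ('d (transition i j) x v)].

(* Exterior derivatives and wedge products, without factorial factors. *)
Definition d1 (al : form1) : tensor2 := fun i x u v =>
  'D_u (fun y => al i y v) x - 'D_v (fun y => al i y u) x.

Definition d2 (om : tensor2) : form3 := fun i x u v w =>
  'D_u (fun y => om i y v w) x - 'D_v (fun y => om i y u w) x
    + 'D_w (fun y => om i y u v) x.

Definition wedge11 (al be : form1) : tensor2 := fun i x u v =>
  al i x u * be i x v - al i x v * be i x u.

Definition wedge12 (al : form1) (om : tensor2) : form3 := fun i x u v w =>
  al i x u * om i x v w - al i x v * om i x u w + al i x w * om i x u v.

(* In holomorphic charts the complex structure J is the constant J0. *)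
Definition Jfield : chart X -> E -> E -> E := fun _ _ v => J0 v.

Definition Jform (al : form1) : form1 := fun i x v => - al i x (Jfield i x v).

Definition hermitian_metric (g : tensor2) : Prop :=
  [/\ is_tensor2 g,
      forall i x, img i x -> forall u v, g i x u v = g i x v u,
      forall i x, img i x -> forall v, v != 0 -> 0 < g i x v v &
      forall i x, img i x -> forall u v,
        g i x (Jfield i x u) (Jfield i x v) = g i x u v].

Definition fundamental_form (g : tensor2) : tensor2 := fun i x u v =>
  g i x (Jfield i x u) v.

Definition kahler_metric (g : tensor2) : Prop :=
  hermitian_metric g /\
  forall i x, img i x -> forall u v w, d2 (fundamental_form g) i x u v w = 0.

Definition kahler_type : Prop := exists g : tensor2, kahler_metric g.

Definition lck_metric (g : tensor2) (th : form1) : Prop :=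
  [/\ hermitian_metric g,
      is_form1 th,
      forall i x, img i x -> forall u v, d1 th i x u v = 0 &
      forall i x, img i x -> forall u v w,
        d2 (fundamental_form g) i x u v w
          = wedge12 th (fundamental_form g) i x u v w].

Definition lee_field (g : tensor2) (th : form1) (B : vfield) : Prop :=
  is_vfield B /\
  forall i x, img i x -> forall v,
    fundamental_form g i x (B i x) v = Jform th i x v.

Definition real_holomorphic (B : vfield) : Prop :=
  forall i x, img i x -> forall v, lie_endo (B i) (Jfield i) x v = 0.

(* The Levi-Civita connection is nabla_u Y = 'D_u Y + G(u, Y) in each chart,
   for the unique bilinear G that is torsion-free and metric; by uniqueness
   these local connections agree on overlaps and G is smooth. *)
Definition levi_civita (g : tensor2) (G : chart X -> E -> E -> E -> E) : Prop :=
  [/\ forall i x, img i x -> forall u,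
        linear (G i x u) /\ linear (fun v => G i x v u),
      forall i x, img i x -> forall u v, G i x u v = G i x v u &
      forall i x, img i x -> forall u v w,
        'D_w (fun y => g i y u v) x
          = g i x (G i x w u) v + g i x u (G i x w v)].

Definition nabla1 (G : chart X -> E -> E -> E -> E) (al : form1) : tensor2 :=
  fun i x u v => 'D_u (fun y => al i y v) x - al i x (G i x u v).

Definition vaisman (g : tensor2) (th : form1) : Prop :=
  lck_metric g th /\
  exists G, levi_civita g G /\
    forall i x, img i x -> forall u v, nabla1 G th i x u v = 0.

End Tensors.

(* Main.v *)
(** Write h = theta(B) - 1/a.  As (J theta)(B) = 0, the structure equation gives
    L_B(J theta) = i_B d(J theta) = h J theta, whereas holomorphy of B and
    d theta = 0 give L_B(J theta) = J d(theta(B)); hence dh = h theta.  By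
    Gronwall the zero set of h is open, so h vanishes identically or nowhere.
    If it vanishes nowhere, then g / |h| is Kaehler.  If h = 0, then
    L_B Omega = h Omega = 0, so B is Killing, and together with d theta = 0 this
    says that theta = g(B, .) is parallel. *)
Require Import Defs.
From mathcomp Require Import all_boot all_order all_algebra.
From mathcomp Require Import all_classical all_reals all_analysis.
From mathcomp Require Import ring lra.

Set Implicit Arguments.
Unset Strict Implicit.
Unset Printing Implicit Defensive.

Import Order.TTheory GRing.Theory Num.Theory.
Import numFieldNormedType.Exports.

Local Open Scope classical_set_scope.
Local Open Scope ring_scope.

(** * C^k maps on open sets of a normed space *)

Section Smoothness.
Context {R : realType} {V : normedModType R}.

(** The first-order expansion of [f] at [x] is also one of [g], with the same linear part ['d f x];
    [diff_unique] then identifies that part with the differential of [g]. *)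
Lemma near_eq_differentiable {W : normedModType R} (f g : V -> W) (x : V) :
  {near x, f =1 g} -> differentiable f x -> differentiable g x.
Proof.
move=> fg df.
have dg : g \o shift x = cst (g x) + 'd f x +o_ 0 id.
  apply/eqaddoE/eqaddoP => e e0.
  have /eqaddoP/(_ e e0) := diff_locally df.
  have fg0 : \forall y \near (0 : V), f (y + x) = g (y + x).
    by have := fg; rewrite (near_shift 0) subr0.
  move=> dfe; near=> y.
  have fgy : f (y + x) = g (y + x) by near: y.
  have : `|(f \o shift x - (cst (f x) + 'd f x)) y| <= e * `|id y| by near: y.
  by rewrite !fctE /= fgy (nbhs_singleton fg).
have dfc := diff_continuous df.
by apply/diff_locallyP; rewrite (diff_unique dfc dg).
Unshelve. all: by end_near. Qed.

Lemma open_eq_near {W : Type} (U : set V) (f g : V -> W) x :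
  open U -> U x -> (forall y, U y -> f y = g y) -> {near x, f =1 g}.
Proof.
by move=> oU Ux fg; apply: filterS (open_nbhs_nbhs (conj oU Ux)) => y /fg.
Qed.

(** Openness of [U] turns equality on [U] into equality near each of its points, which is all that
    limits and derivatives see. *)
Lemma eq_Ck {W : normedModType R} k (U : set V) (f g : V -> W) :
  open U -> (forall x, U x -> f x = g x) -> Ck k U f -> Ck k U g.
Proof.
move=> oU; elim: k f g => [|k IH] f g fg /= => [cf x Ux|[df Df]].
  rewrite /prop_for /continuous_at -(fg x Ux).
  by apply: cvg_trans (cf x Ux); apply: near_eq_cvg; exact: (open_eq_near oU).
split=> [x Ux|v].
  by apply: near_eq_differentiable (df x Ux); exact: (open_eq_near oU).
apply: IH (Df v) => x Ux; apply: near_eq_derive; exact: (open_eq_near oU).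
Qed.

Lemma CkS {W : normedModType R} k (U : set V) (f : V -> W) :
  Ck k.+1 U f -> Ck k U f.
Proof.
elim: k f => [|k IH] f [df Df]; first by move=> x /df/differentiable_continuous.
by split=> // v; exact: IH.
Qed.

Lemma Ck_cst {W : normedModType R} k (U : set V) (c : W) : Ck k U (cst c).
Proof.
elim: k c => [|k IH] c; first by move=> x _; exact: cst_continuous.
split=> [x _|v]; first exact: differentiable_cst.
have -> : 'D_v (cst c) = cst 0 :> (V -> W) by apply/funext => x; rewrite derive_cst.
exact: IH.
Qed.

Lemma CkD {W : normedModType R} k (U : set V) (f g : V -> W) :
  open U -> Ck k U f -> Ck k U g -> Ck k U (f + g).
Proof.
move=> oU; elim: k f g => [|k IH] f g /= => [cf cg x Ux|[df Df] [dg Dg]].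
  by apply: cvgD; [exact: cf|exact: cg].
split=> [x Ux|v]; first by apply: differentiableD; [exact: df|exact: dg].
apply: eq_Ck (IH _ _ (Df v) (Dg v)) => // x Ux.
by rewrite deriveD//; apply: diff_derivable; [exact: df|exact: dg].
Qed.

Lemma CkM k (U : set V) (f g : V -> R) :
  open U -> Ck k U f -> Ck k U g -> Ck k U (f * g).
Proof.
move=> oU; elim: k f g => [|k IH] f g => [cf cg x Ux|Cf Cg].
  by apply: cvgM; [exact: cf|exact: cg].
have [df Df] := Cf; have [dg Dg] := Cg.
split=> [x Ux|v]; first by apply: differentiableM; [exact: df|exact: dg].
(* The Leibniz rule involves [f] and [g] themselves, not only their derivatives, so they are also
   needed one order lower; [CkS] provides this. *)
apply: (@eq_Ck _ k U (f * 'D_v g + g * 'D_v f)) => //.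
  move=> x Ux; rewrite deriveM//; apply: diff_derivable; [exact: df|exact: dg].
apply: CkD => //; apply: IH => //.
- exact: CkS Cf.
- exact: Dg.
- exact: CkS Cg.
- exact: Df.
Qed.

Lemma smooth_differentiable {W : normedModType R} (U : set V) (f : V -> W) x :
  smooth_on U f -> U x -> differentiable f x.
Proof. by move=> /(_ 1%N) [df _]; exact: df. Qed.

(* Bootstrapping: if [k] is C^m then so is [D_v k = k * f v], so [k] is
   C^(m+1). *)
Lemma smooth_log_derivative (U : set V) (k : V -> R) (f : V -> V -> R) :
  open U -> (forall x, U x -> differentiable k x) ->
  (forall v, smooth_on U (f v)) ->
  (forall x v, U x -> 'D_v k x = k x * f v x) -> smooth_on U k.
Proof.
move=> oU dk fs Dk; elim=> [|m IH].
  by move=> x /dk/differentiable_continuous.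
split=> // v; apply: (@eq_Ck _ _ _ (k * f v)) => //.
  by move=> x Ux; rewrite Dk.
by apply: CkM => //; exact: fs.
Qed.

Section InverseNorm.
Variables (f : V -> R) (x : V).
Hypotheses (df : differentiable f x) (fx0 : f x != 0).

(** By continuity [f] keeps the sign of [f x] near [x], so the norm is locally multiplication by a
    constant and need not be differentiated. *)
Let inv_norm_near :
  {near x, (fun y => (Num.sg (f x) * f y)^-1) =1 (fun y => `|f y|^-1)}.
Proof.
have cf := differentiable_continuous df.
move: (fx0); rewrite neq_lt => /orP[fx|fx].
  apply: filterS (cvgr_lt (f x) cf 0 fx) => y fy.
  by rewrite ltr0_sg// mulN1r ltr0_norm.
apply: filterS (cvgr_gt (f x) cf 0 fx) => y fy.
by rewrite gtr0_sg// mul1r gtr0_norm.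
Qed.

Let dsg : differentiable (fun y => Num.sg (f x) * f y) x.
Proof. exact: (differentiableZ (Num.sg (f x)) df). Qed.

Let sg_neq0 : Num.sg (f x) * f x != 0.
Proof. by rewrite mulf_neq0 ?sgr_eq0. Qed.

Lemma differentiable_inv_norm : differentiable (fun y => `|f y|^-1) x.
Proof.
apply: near_eq_differentiable inv_norm_near _; exact: differentiableV.
Qed.

Lemma derive_inv_norm v :
  'D_v (fun y => `|f y|^-1) x = - (`|f x|^-1 * (f x)^-1 * 'D_v f x).
Proof.
rewrite -(near_eq_derive v inv_norm_near) deriveV//; last exact: diff_derivable.
have -> : 'D_v (fun y => Num.sg (f x) * f y) x = Num.sg (f x) * 'D_v f x.
  by apply: (deriveZ (Num.sg (f x))); exact: diff_derivable.
rewrite normrEsg /GRing.scale/=.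
by field; rewrite fx0 sgr_eq0.
Qed.

End InverseNorm.

End Smoothness.

(** * Algebra of linear forms *)

Section ScalarForms.
Context {R : comNzRingType} {V : lmodType R} (al : V -> R).
Hypothesis al_lin : scalar al.

Lemma scalar_form0 : al 0 = 0.
Proof.
have := al_lin (-1) 0 0; rewrite scaler0 addr0 mulN1r => h.
by rewrite h addNr.
Qed.

Lemma scalar_formD u v : al (u + v) = al u + al v.
Proof. by rewrite -{1}[u]scale1r al_lin mul1r. Qed.

Lemma scalar_formZ c u : al (c *: u) = c * al u.
Proof. by rewrite -{1}[c *: u]addr0 al_lin scalar_form0 addr0. Qed.

Lemma scalar_formN u : al (- u) = - al u.
Proof. by rewrite -scaleN1r scalar_formZ mulN1r. Qed.

Lemma scalar_formB u v : al (u - v) = al u - al v.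
Proof. by rewrite scalar_formD scalar_formN. Qed.

Lemma scalar_form_sum (I : finType) (F : I -> V) :
  al (\sum_i F i) = \sum_i al (F i).
Proof.
apply: (big_ind2 (fun x y => al x = y)) => //; first exact: scalar_form0.
by move=> x _ y _ <- <-; rewrite scalar_formD.
Qed.

End ScalarForms.

Lemma scalar_form_rowE {R : comNzRingType} m (al : 'rV[R]_m -> R) v :
  scalar al -> al v = \sum_k v 0 k * al (delta_mx 0 k).
Proof.
move=> al_lin; rewrite {1}[v]row_sum_delta scalar_form_sum//.
by apply: eq_bigr => k _; rewrite scalar_formZ.
Qed.

(** * Differentiation of forms in coordinates, and the Gronwall estimate *)

Section FormCalculus.
Context {R : realType} {m : nat}.
Local Notation E := 'rV[R]_m.
Implicit Types (al : E -> E -> R) (Y : E -> E).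

Lemma differentiable_entry Y x k :
  differentiable Y x -> differentiable (fun y => Y y 0 k) x.
Proof.
move=> dY; apply: (@differentiable_comp _ _ _ _ Y (fun N : E => N 0 k : R)) => //.
exact: differentiable_coord.
Qed.

Lemma derive_entry Y x w k :
  differentiable Y x -> 'D_w (fun y => Y y 0 k) x = ('D_w Y x) 0 k.
Proof. by move=> dY; rewrite derive_mx ?mxE//; exact: diff_derivable. Qed.

Section Contraction.
Variables (al : E -> E -> R) (Y : E -> E) (x : E).
Hypothesis al_lin : \forall y \near x, scalar (al y).
Hypothesis dal : forall v, differentiable (al^~ v) x.
Hypothesis dY : differentiable Y x.

(** Coordinate expansion of the contraction. It agrees with [al y (Y y)] only near [x], where [al y]
    is known to be linear. *)
Let S := \sum_k ((fun y => Y y 0 k) * (al^~ (delta_mx 0 k))).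

Let contraction_near : {near x, S =1 (fun y => al y (Y y))}.
Proof.
apply: filterS al_lin => y aly.
by rewrite (scalar_form_rowE _ aly) /S fct_sumE.
Qed.

Lemma differentiable_contraction : differentiable (fun y => al y (Y y)) x.
Proof.
apply: near_eq_differentiable contraction_near _.
apply: differentiable_sum => k; apply: differentiableM => //.
exact: differentiable_entry.
Qed.

(** The product rule, applied to each term of the coordinate expansion [S]. In the first summand the
    vector is frozen at [Y x], in the second the form is frozen at [x]. *)
Lemma derive_contraction w :
  'D_w (fun y => al y (Y y)) x
    = 'D_w (fun y => al y (Y x)) x + al x ('D_w Y x).
Proof.
have dYk k := differentiable_entry k dY.
have alx := nbhs_singleton al_lin.
transitivity (\sum_k ((Y x 0 k) * 'D_w (al^~ (delta_mx 0 k)) x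
                      + al x (delta_mx 0 k) * ('D_w Y x) 0 k)).
  rewrite -(near_eq_derive w contraction_near) derive_sum => [|k]; last first.
    by apply: diff_derivable; exact: differentiableM.
  apply: eq_bigr => k _.
  by rewrite deriveM; [rewrite derive_entry|exact: diff_derivable..].
rewrite big_split/=; congr (_ + _); last first.
  rewrite (scalar_form_rowE _ alx); apply: eq_bigr => k _; exact: mulrC.
have -> : 'D_w (fun y => al y (Y x)) x
        = 'D_w (\sum_k (Y x 0 k *: (al^~ (delta_mx 0 k)))) x.
  apply: near_eq_derive; apply: filterS al_lin => y aly.
  by rewrite (scalar_form_rowE _ aly) fct_sumE.
rewrite derive_sum => [|k]; last first.
  by apply: diff_derivable; exact: differentiableZ.
by apply: eq_bigr => k _; rewrite deriveZ//; exact: diff_derivable.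
Qed.

End Contraction.

Lemma derive_scalar_form al x w :
  (\forall y \near x, scalar (al y)) -> (forall v, differentiable (al^~ v) x) ->
  scalar (fun v => 'D_w (al^~ v) x).
Proof.
move=> al_lin dal c u v.
have -> : 'D_w (al^~ (c *: u + v)) x = 'D_w (c *: (al^~ u) + (al^~ v)) x.
  by apply: near_eq_derive; apply: filterS al_lin => y ->.
rewrite deriveD ?deriveZ//; apply: diff_derivable => //; exact: differentiableZ.
Qed.

Lemma derive_scalar (f : E -> R) x :
  differentiable f x -> scalar (fun w => 'D_w f x).
Proof. by move=> df c u v; rewrite !deriveE// linearP. Qed.

(** The two derivatives are limits of the same difference quotient. *)
Lemma is_derive_line (h : E -> R) (x v : E) (t : R) :
  differentiable h (x + t *: v) ->
  is_derive t 1 (fun s => h (x + s *: v)) ('D_v h (x + t *: v)).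
Proof.
move=> dh.
have lineE : (fun s : R => s^-1 *: (h (x + (s *: 1 + t) *: v) - h (x + t *: v)))
    = (fun s => s^-1 *: (h (s *: v + (x + t *: v)) - h (x + t *: v))).
  apply/funext => s; congr (_ *: (h _ - _)).
  by rewrite scalerDl [_ *: 1]mulr1 addrCA.
apply: DeriveDef; last by rewrite /derive lineE.
have dhv : derivable h (x + t *: v) v by exact: diff_derivable.
by rewrite /derivable lineE.
Qed.

(* Gronwall on short segments: with [|th v| <= 1/2] along the segment, the
   maximum of [|h|] is at most half of itself. *)
Lemma log_derivative_zero_near (U : set E) (h : E -> R) (th : E -> E -> R) x0 :
  open U -> U x0 -> (forall x, U x -> differentiable h x) ->
  (forall x, U x -> scalar (th x)) ->
  (forall v, {for x0, continuous (th^~ v)}) ->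
  (forall x v, U x -> 'D_v h x = h x * th x v) ->
  h x0 = 0 -> \forall x \near x0, h x = 0.
Proof.
move=> oU Ux0 dh th_lin th_cont Dh hx0.
(* Near [x0] each coefficient of [th] exceeds its value at [x0] by at most 1 in norm, so there [K]
   bounds the sum of their norms. *)
pose K := \sum_k (`|th x0 (delta_mx 0 k)| + 1).
have K_ge0 : 0 <= K by apply: sumr_ge0 => k _; rewrite addr_ge0.
have bound : \forall y \near x0,
    U y /\ forall k, `|th y (delta_mx 0 k)| <= `|th x0 (delta_mx 0 k)| + 1.
  near=> y; split; first by near: y; exact: open_nbhs_nbhs.
  near: y; apply: filter_forall => k.
  have /cvgrPdist_le/(_ 1 ltr01) := th_cont (delta_mx 0 k).
  apply: filterS => y.
  by rewrite distrC -lerBlDl; apply: le_trans; exact: lerB_dist.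
have /nbhs_ballP[r /= r0 rU] := bound.
(* The second bound gives [|v| * K <= 1/2]; taking [K + 1] keeps the denominator positive even if
   [K] is 0. *)
pose e := Num.min r (2 * (K + 1))^-1.
have e0 : 0 < e by rewrite lt_min r0 invr_gt0 mulr_gt0// ltr_wpDl.
apply/nbhs_ballP; exists e => //= x; rewrite -ball_normE /ball_/= => xe.
pose v := x - x0.
have ve : `|v| < e by rewrite /v distrC.
pose phi (t : R) := h (x0 + t *: v).
have inU (t : R) : t \in `[0, 1]%R -> ball x0 r (x0 + t *: v).
  rewrite in_itv/= => /andP[t0 t1]; rewrite -ball_normE /ball_/= opprD addNKr.
  rewrite normrN normrZ ger0_norm//.
  apply: le_lt_trans (_ : `|v| < r); first by rewrite ler_piMl.
  by apply: lt_le_trans ve _; rewrite ge_min lexx.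
have thv (t : R) : t \in `[0, 1]%R -> `|th (x0 + t *: v) v| <= 2^-1.
  move=> /inU/rU[Uy thy].
  rewrite (scalar_form_rowE _ (th_lin _ Uy)).
  apply: le_trans (_ : `|v| * K <= _).
    apply: le_trans (ler_norm_sum _ _ _) _; rewrite /K mulr_sumr.
    apply: ler_sum => k _; rewrite normrM; apply: ler_pM => //.
    rewrite [leRHS]/Num.Def.normr/= mx_normrE.
    exact: (le_bigmax _ (fun ij : 'I_1 * 'I_m => `|v ij.1 ij.2|) (ord0, k)).
  have vK : `|v| <= (2 * (K + 1))^-1.
    by apply: le_trans (ltW ve) _; rewrite ge_min lexx orbT.
  apply: le_trans (_ : (2 * (K + 1))^-1 * (K + 1) <= _).
    by apply: ler_pM => //; rewrite lerDl.
  by rewrite invfM -mulrA mulVf ?mulr1// gt_eqF// ltr_wpDl.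
have dphi (t : R) : t \in `[0, 1]%R ->
    is_derive t 1 phi (phi t * th (x0 + t *: v) v).
  move=> /inU/rU[Uy _].
  by rewrite /phi -Dh//; apply: is_derive_line; exact: dh.
have cphi (c : R) : c <= 1 -> {within `[0, c], continuous phi}.
  move=> c1; apply: derivable_within_continuous => t.
  rewrite in_itv/= => /andP[t0 tc].
  have t01 : t \in `[0, 1]%R by rewrite in_itv/= t0 (le_trans tc).
  by have [] := dphi _ t01.
have cnphi : {within `[0, 1], continuous (fun t => `|phi t|)}.
  by move=> t; apply: cvg_norm; exact: cphi.
(* [c] is where [|phi|] is largest on the segment. The mean value theorem on [[0, c]], with
   [phi 0 = 0], will bound [|phi c|] by [|phi d| / 2], hence by [|phi c| / 2]. *)
have [c c01 cmax] := EVT_max ler01 cnphi.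
have /andP[c0 c1] : 0 <= c <= 1 by rewrite in_itv in c01.
have sub01 (d : R) : d \in `[0, c]%R -> d \in `[0, 1]%R.
  by rewrite !in_itv/= => /andP[-> /le_trans->].
have dphi_oo (t : R) : t \in `]0, c[%R ->
    is_derive t 1 phi (phi t * th (x0 + t *: v) v).
  by move=> t0c; apply: dphi; apply: sub01; exact: subset_itv_oo_cc t0c.
have [d dc] := MVT_segment c0 dphi_oo (cphi _ c1).
have phi0 : phi 0 = 0 by rewrite /phi scale0r addr0.
rewrite phi0 !subr0 => phic.
have phic0 : `|phi c| = 0.
  have : `|phi c| <= `|phi c| * 2^-1 * 1.
    rewrite {1}phic !normrM; apply: ler_pM; rewrite ?mulr_ge0 ?normr_ge0//.
      by apply: ler_pM; rewrite ?normr_ge0 ?cmax ?thv ?sub01.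
    by rewrite ger0_norm.
  have := normr_ge0 (phi c); lra.
have := cmax 1; rewrite phic0 in_itv/= ler01 lexx => /(_ isT).
by rewrite normr_le0 /phi scale1r /v addrC subrK => /eqP.
Unshelve. all: by end_near. Qed.

End FormCalculus.

(** * The standard complex structure *)

Section ComplexStructure.
Context {R : realType} {n : nat}.
Implicit Types u v : 'rV[R]_(n + n).

Lemma J0_linear : linear (@J0 R n).
Proof.
move=> c u v; rewrite /J0 (linearP rsubmx) (linearP lsubmx) opprD -scalerN.
by rewrite scale_row_mx add_row_mx.
Qed.

Lemma J0K v : J0 (J0 v) = - v.
Proof. by rewrite /J0 row_mxKl row_mxKr -opp_row_mx hsubmxK. Qed.

Lemma J0N v : J0 (- v) = - J0 v.
Proof. by rewrite /J0 !linearN/= opp_row_mx. Qed.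

End ComplexStructure.

(** * Duality for a positive definite bilinear form *)

Section PositiveDefinite.
Context {R : realType} {m : nat} (b : 'rV[R]_m -> 'rV[R]_m -> R).
Hypothesis b_bilin : forall u, scalar (b u) /\ scalar (fun v => b v u).
Hypothesis b_pos : forall v, v != 0 -> 0 < b v v.

Lemma nondegenerate u v : (forall w, b u w = b v w) -> u = v.
Proof.
move=> buv; apply/eqP; rewrite -subr_eq0; apply/negP => /negP/b_pos.
by rewrite (scalar_formB (b_bilin _).2) buv subrr ltxx.
Qed.

(** The Gram matrix of [b] has trivial kernel by [nondegenerate], so it is invertible and the linear
    system for the coordinates of [z] can be solved. *)
Lemma riesz (phi : 'rV[R]_m -> R) :
  scalar phi -> exists z, forall w, b z w = phi w.
Proof.
move=> phi_lin.
pose A := \matrix_(k, l) b (delta_mx 0 k) (delta_mx 0 l).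
have bE z l : b z (delta_mx 0 l) = (z *m A) 0 l.
  rewrite (scalar_form_rowE z (b_bilin _).2) mxE.
  by apply: eq_bigr => k _; rewrite mxE.
have A_unit : A \in unitmx.
  rewrite -row_free_unit; apply: inj_row_free => z zA0.
  apply: nondegenerate => w.
  rewrite (scalar_form_rowE w (b_bilin _).1) (scalar_form0 (b_bilin _).2).
  by rewrite big1// => l _; rewrite bE zA0 mxE mulr0.
exists ((\row_k phi (delta_mx 0 k)) *m invmx A) => w.
rewrite (scalar_form_rowE w (b_bilin _).1) (scalar_form_rowE w phi_lin).
by apply: eq_bigr => l _; rewrite bE mulmxKV// mxE.
Qed.

End PositiveDefinite.

(** * The Levi-Civita connection of a Hermitian metric *)

Section Metric.
Context {R : realType} {n : nat} {M : topologicalType}.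
Variable X : complexManifold R n M.
Local Notation E := 'rV[R]_(n + n).

Lemma chart_near (i : chart X) (P : E -> Prop) x :
  img i x -> (forall y, img i y -> P y) -> \forall y \near x, P y.
Proof.
move=> ix iP; have := open_nbhs_nbhs (conj (@img_open _ _ _ X i) ix).
by apply: filterS; exact: iP.
Qed.

Lemma near_derive_eq (i : chart X) (f f' : E -> R) x w :
  img i x -> (forall y, img i y -> f y = f' y) -> 'D_w f x = 'D_w f' x.
Proof. by move=> ix ff'; apply: near_eq_derive; exact: chart_near ix ff'. Qed.

Section LeviCivita.
Variable g : tensor2 X.
Hypothesis g_herm : hermitian_metric g.

Lemma hermitian_bilin i x : img i x ->
  forall u, scalar (g i x u) /\ scalar (fun v => g i x v u).
Proof. by case: g_herm => -[+ _ _] _ _ _; exact. Qed.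

Lemma hermitian_differentiable i x u v :
  img i x -> differentiable (fun y => g i y u v) x.
Proof.
by case: g_herm => -[_ + _] _ _ _ => /(_ i u v)/smooth_differentiable; exact.
Qed.

Lemma hermitian_sym i x u v : img i x -> g i x u v = g i x v u.
Proof. by case: g_herm => _ + _ _ => /[apply]; exact. Qed.

Lemma hermitian_pos i x v : img i x -> v != 0 -> 0 < g i x v v.
Proof. by case: g_herm => _ _ + _ => /[apply]; exact. Qed.

Lemma hermitian_J i x u v : img i x -> g i x (J0 u) (J0 v) = g i x u v.
Proof. by case: g_herm => _ _ _ + => /[apply]; exact. Qed.

(** The Koszul formula for constant coordinate fields, whose brackets vanish: the Christoffel
    symbols of the first kind. *)
Definition koszul (i : chart X) x u v w : R :=
  2^-1 * ('D_u (fun y => g i y v w) x + 'D_v (fun y => g i y u w) x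
          - 'D_w (fun y => g i y u v) x).

Let derive_metric_arg1 i x w v : img i x ->
  scalar (fun u => 'D_w (fun y => g i y u v) x).
Proof.
move=> ix; apply: (@derive_scalar_form _ _ (fun y u => g i y u v)).
  by apply: (chart_near ix) => y iy; have [] := hermitian_bilin iy v.
by move=> u; exact: hermitian_differentiable.
Qed.

Let derive_metric_sym i x w u v : img i x ->
  'D_w (fun y => g i y u v) x = 'D_w (fun y => g i y v u) x.
Proof. by move=> ix; apply: (near_derive_eq w ix) => y; exact: hermitian_sym. Qed.

Let derive_metric_dir i x u v : img i x ->
  scalar (fun w => 'D_w (fun y => g i y u v) x).
Proof. by move=> ix; apply: derive_scalar; exact: hermitian_differentiable. Qed.

Lemma koszul_sym i x u v w : img i x -> koszul i x u v w = koszul i x v u w.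
Proof. by move=> ix; rewrite /koszul (derive_metric_sym w u v ix); ring. Qed.

Lemma koszul_scalar1 i x v w : img i x -> scalar (fun u => koszul i x u v w).
Proof.
move=> ix c u u'; rewrite /koszul (derive_metric_dir v w ix).
by rewrite (derive_metric_arg1 v w ix) (derive_metric_arg1 w v ix); ring.
Qed.

Lemma koszul_scalar3 i x u v : img i x -> scalar (koszul i x u v).
Proof.
move=> ix c w w'; rewrite /koszul (derive_metric_dir u v ix).
rewrite !(derive_metric_sym _ _ (_ + _) ix).
rewrite (derive_metric_arg1 u v ix) (derive_metric_arg1 v u ix).
by rewrite !(derive_metric_sym _ _ w ix) !(derive_metric_sym _ _ w' ix); ring.
Qed.

(** The index is raised by choosing the vector that represents [koszul]. Over [img i] it exists by
    [riesz] and is unique, so the default 0 is never taken there. *)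
Definition christoffel (i : chart X) x u v : E :=
  xget 0 [set z | forall w, g i x z w = koszul i x u v w].

Lemma christoffelE i x u v w :
  img i x -> g i x (christoffel i x u v) w = koszul i x u v w.
Proof.
move=> ix; rewrite /christoffel; case: xgetP => [z _|/= noz]; first exact.
have [z zE] := riesz (hermitian_bilin ix) (fun v => @hermitian_pos i x v ix)
  (koszul_scalar3 u v ix).
by have := noz z.
Qed.

Lemma christoffel_sym i x u v :
  img i x -> christoffel i x u v = christoffel i x v u.
Proof.
move=> ix.
apply: (nondegenerate (hermitian_bilin ix)
    (fun v => @hermitian_pos i x v ix)) => w.
by rewrite !christoffelE// koszul_sym.
Qed.

Lemma levi_civita_christoffel : levi_civita g christoffel.
Proof.
have lin1 i x v : img i x -> linear (fun u => christoffel i x u v).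
  move=> ix c u u'.
  apply: (nondegenerate (hermitian_bilin ix)
    (fun v => @hermitian_pos i x v ix)) => w.
  rewrite christoffelE// (koszul_scalar1 v w ix).
  by rewrite (hermitian_bilin ix w).2 !christoffelE.
split=> [i x ix u|i x ix u v|i x ix u v w]; last 2 first.
- exact: christoffel_sym.
(* In the sum of the Koszul expressions for [(w, u, v)] and [(w, v, u)] all terms cancel except the
   derivative along [w]. *)
- rewrite (hermitian_sym u) // !christoffelE// /koszul.
  rewrite (derive_metric_sym w v u ix).
  by field.
split; last exact: lin1.
by move=> c v v'; rewrite !(christoffel_sym u)//; exact: lin1.
Qed.

End LeviCivita.

End Metric.

(** * Functions with dh = h theta, and conformal change to a Kähler metric *)

Section LogDerivative.
Context {R : realType} {n : nat} {M : topologicalType}.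
Variable X : complexManifold R n M.
Local Notation E := 'rV[R]_(n + n).

Section OneForm.
Variable th : form1 X.
Hypothesis th_form : is_form1 th.

Lemma form1_scalar i x : img i x -> scalar (th i x).
Proof. by case: th_form => + _ _; exact. Qed.

Lemma form1_differentiable i x v :
  img i x -> differentiable (fun y => th i y v) x.
Proof. by case: th_form => _ + _ => /(_ i v)/smooth_differentiable; exact. Qed.

Variable h : chart X -> E -> R.
Hypothesis h_glue : forall i j x, overlap i j x -> h i x = h j (transition i j x).
Hypothesis dh : forall i x, img i x -> differentiable (h i) x.
Hypothesis Dh : forall i x v, img i x -> 'D_v (h i) x = h i x * th i x v.

(** The local expressions of [h] thus define one function on [M], whose zero set can be studied
    there. *)
Lemma glue_coord i j p :
  dom i p -> dom j p -> h i (Defs.coord i p) = h j (Defs.coord j p).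
Proof.
move=> ip jp; have pK := coordK ip.
rewrite (@h_glue i j) /transition /= ?pK//.
by split; [exact: coord_img | rewrite pK].
Qed.

Let Z := [set p : M | exists2 i, dom i p & h i (Defs.coord i p) = 0].

Let chart_nbhs (i : chart X) p (P : E -> Prop) :
  dom i p -> (\forall y \near Defs.coord i p, P y) ->
  \forall q \near p, dom i q /\ P (Defs.coord i q).
Proof.
move=> ip Pp; near=> q; split; near: q.
  by apply: open_nbhs_nbhs; split=> //; exact: dom_open.
exact: (Defs.coord_continuous ip Pp).
Unshelve. all: by end_near. Qed.

(** The Gronwall estimate in one chart, carried to [M] by the continuity of the coordinate map. *)
Let Z_open : open Z.
Proof.
rewrite openE => p [i ip h0]; rewrite /interior.
have : \forall y \near Defs.coord i p, h i y = 0.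
  apply: (@log_derivative_zero_near _ _ (img i) (h i) (th i)) => //.
  - exact: img_open.
  - exact: coord_img.
  - exact: dh.
  - exact: form1_scalar.
  - move=> v; apply: differentiable_continuous.
    exact/form1_differentiable/coord_img.
  - by move=> x v ix; rewrite Dh.
by move=> /(chart_nbhs ip); apply: filterS => q [iq hq]; exists i.
Qed.

(** Nonvanishing is an open condition in one chart; by [glue_coord] no other chart can then exhibit
    a zero at the same point. *)
Let Z_closed : closed Z.
Proof.
rewrite -openC openE => p nZp; rewrite /interior.
have [i ip] := dom_cover X p.
have hp : h i (Defs.coord i p) != 0 by apply/eqP => hp; apply: nZp; exists i.
have : \forall y \near Defs.coord i p, h i y != 0.
  have /differentiable_continuous := dh (coord_img ip).
  move=> /cvgr_neq0; exact.
move=> /(chart_nbhs ip); apply: filterS => q [iq hq] [j jq hj].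
by move: hq; rewrite (glue_coord iq jq) hj eqxx.
Qed.

Lemma log_derivative_dichotomy : connected [set: M] ->
  (forall i x, img i x -> h i x = 0) \/ (forall i x, img i x -> h i x != 0).
Proof.
move=> Mc; have [[p Zp]|noZ] := pselect (Z !=set0); [left|right] => i x ix.
  have ZT : Z = setT.
    apply: Mc; first by exists p.
      by exists Z => //; rewrite setTI.
    by exists Z => //; rewrite setTI.
  have [j jx] : Z (param i x) by rewrite ZT.
  by rewrite -(glue_coord (param_dom ix) jx) paramK.
apply/eqP => hx; apply: noZ; exists (param i x), i; first exact: param_dom.
by rewrite paramK.
Qed.

End OneForm.

(** With dk = -k theta, d(k Omega) = dk ∧ Omega + k dOmega = -k theta ∧ Omega + k theta ∧ Omega =
    0. *)
Lemma conformal_kahler (g : tensor2 X) (th : form1 X) (k : chart X -> E -> R) :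
  lck_metric g th ->
  (forall i x, img i x -> 0 < k i x) ->
  (forall i j x, overlap i j x -> k i x = k j (transition i j x)) ->
  (forall i x, img i x -> differentiable (k i) x) ->
  (forall i x v, img i x -> 'D_v (k i) x = - (k i x * th i x v)) ->
  kahler_type X.
Proof.
move=> [g_herm th_form _ dOmega] k_pos k_glue dk Dk.
have [[g_lin g_smooth g_glue] g_sym g_pos g_J] := g_herm.
(* A metric has to be smooth while [k] is only assumed differentiable; the equation for its
   derivative makes up the difference. *)
have k_smooth i : smooth_on (img i) (k i).
  apply: (@smooth_log_derivative _ _ _ _ (fun v y => - th i y v)).
  - exact: img_open.
  - exact: dk.
  - move=> v m.
    apply: (@eq_Ck _ _ _ _ _ (cst (-1) * (fun y => th i y v))).
    + exact: img_open.
    + by move=> x _; rewrite !fctE mulN1r.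
    + apply: CkM; first exact: img_open.
        by apply: Ck_cst.
      by case: th_form => _ + _; exact.
  - by move=> x v ix; rewrite Dk// mulrN.
exists (fun i x u v => k i x * g i x u v); split; first split.
- split.
  + move=> i x ix u; have [gu1 gu2] := g_lin i x ix u.
    by split=> c v v'; [rewrite gu1|rewrite gu2]; ring.
  + move=> i u v m; apply: (@CkM _ _ m (img i) (k i) (fun x => g i x u v)).
    * exact: img_open.
    * exact: k_smooth.
    * exact: g_smooth.
  + by move=> i j x ijx u v; rewrite (k_glue i j)// (g_glue i j).
- by move=> i x ix u v; rewrite g_sym.
- by move=> i x ix v v0; rewrite mulr_gt0 ?k_pos ?g_pos.
- by move=> i x ix u v; rewrite g_J.
move=> i x ix u v w.
have D p q r : 'D_p (fun y => k i y * g i y (J0 q) r) x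
    = k i x * ('D_p (fun y => g i y (J0 q) r) x - th i x p * g i x (J0 q) r).
  rewrite -[LHS]/('D_p (k i * (fun y => g i y (J0 q) r)) x) deriveM.
  - by rewrite Dk// /GRing.scale/=; ring.
  - exact/diff_derivable/dk.
  - exact/diff_derivable/(hermitian_differentiable g_herm).
have := dOmega i x ix u v w.
rewrite /d2 /wedge12 /fundamental_form /Jfield !D => dO.
rewrite -[RHS](mulr0 (k i x)) -!mulrBr -mulrDr; congr (_ * _).
move: dO; set a1 := 'D_u _ _; set a2 := 'D_v _ _; set a3 := 'D_w _ _ => dO.
move: dO => /(canRL (addrK _))/(canRL (subrK _)) ->; ring.
Qed.

(** The factor 1/|h| satisfies dk = -k theta whatever the sign of h; the absolute value keeps the
    rescaled metric positive. *)
Lemma inv_norm_kahler (g : tensor2 X) (th : form1 X) (h : chart X -> E -> R) :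
  lck_metric g th ->
  (forall i x, img i x -> h i x != 0) ->
  (forall i j x, overlap i j x -> h i x = h j (transition i j x)) ->
  (forall i x, img i x -> differentiable (h i) x) ->
  (forall i x v, img i x -> 'D_v (h i) x = h i x * th i x v) ->
  kahler_type X.
Proof.
move=> g_lck h_neq0 h_glue dh Dh.
apply: (@conformal_kahler g th (fun i x => `|h i x|^-1)) => //.
- by move=> i x ix; rewrite invr_gt0 normr_gt0 h_neq0.
- by move=> i j x ijx; rewrite (h_glue i j).
- by move=> i x ix; apply: differentiable_inv_norm; [exact: dh|exact: h_neq0].
- move=> i x v ix; rewrite derive_inv_norm; [|exact: dh|exact: h_neq0].
  by rewrite Dh// -mulrA mulKf// h_neq0.
Qed.

End LogDerivative.

(** * The Lee field and the defect of its squared norm *)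

Section LeeField.
Context {R : realType} {n : nat} {M : topologicalType}.
Variable X : complexManifold R n M.
Local Notation E := 'rV[R]_(n + n).
Variables (g : tensor2 X) (th : form1 X) (a : R) (B : vfield X).
Hypothesis g_lck : lck_metric g th.
Hypothesis a_gt0 : 0 < a.
Hypothesis Omega_eq : forall (i : chart X) x, img i x -> forall u v,
  fundamental_form g i x u v
    = - a * d1 (Jform th) i x u v
      + wedge11 th (fun j y w => a * Jform th j y w) i x u v.
Hypothesis B_lee : lee_field g th B.
Hypothesis B_hol : real_holomorphic B.

Let g_herm : hermitian_metric g. Proof. by case: g_lck. Qed.
Let th_form : is_form1 th. Proof. by case: g_lck. Qed.
Let Om := fundamental_form g.
Let eta := Jform th.

Lemma lee_differentiable i x : img i x -> differentiable (B i) x.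
Proof. by case: B_lee => -[Bs _] _; exact: smooth_differentiable. Qed.

(** g(B, v) = Omega(B, Jv) = (J theta)(Jv) = theta(v). *)
Lemma lee_dual i x v : img i x -> g i x (B i x) v = th i x v.
Proof.
move=> ix; rewrite -(hermitian_J g_herm _ _ ix).
have [_ /(_ i x ix (J0 v))] := B_lee.
rewrite /fundamental_form /Jform /Jfield => ->.
by rewrite J0K (scalar_formN (form1_scalar th_form ix)) opprK.
Qed.

Lemma lee_dualJ i x v : img i x -> Om i x (B i x) v = eta i x v.
Proof. by case: B_lee => _ + ix; exact. Qed.

Lemma fundamental_form_anti i x u v : img i x -> Om i x u v = - Om i x v u.
Proof.
move=> ix; rewrite /Om /fundamental_form /Jfield.
rewrite -(hermitian_J g_herm (J0 u) v ix) J0K.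
rewrite (scalar_formN (hermitian_bilin g_herm ix _).2).
by rewrite (hermitian_sym g_herm u _ ix).
Qed.

Lemma Jform_lee i x : img i x -> eta i x (B i x) = 0.
Proof.
move=> ix; have := fundamental_form_anti (B i x) (B i x) ix.
by rewrite lee_dualJ// => eB; lra.
Qed.

Lemma Jform_scalar i x : img i x -> scalar (eta i x).
Proof.
move=> ix c u v; rewrite /eta /Jform /Jfield J0_linear.
by rewrite (form1_scalar th_form ix); ring.
Qed.

Lemma Jform_differentiable i x v :
  img i x -> differentiable (fun y => eta i y v) x.
Proof.
move=> ix; apply: (differentiableN (f := fun y => th i y (J0 v))).
exact: (form1_differentiable th_form).
Qed.

(** In a holomorphic chart L_B J = 0 amounts to the Cauchy-Riemann equations for the components of
    [B]: brackets with constant fields retain only derivatives of [B]. *)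
Lemma derive_lee_J i x v :
  img i x -> 'D_(J0 v) (B i) x = J0 ('D_v (B i) x).
Proof.
move=> ix; have := B_hol ix v; rewrite /lie_endo /lie_bracket /Jfield.
rewrite !derive_cst !sub0r J0N opprK addrC => /eqP.
by rewrite subr_eq0 => /eqP.
Qed.

Let near_img_scalar (al : form1 X) i x : img i x ->
  (forall y, img i y -> scalar (al i y)) -> \forall y \near x, scalar (al i y).
Proof. by move=> ix al_lin; apply: (chart_near ix) => y; exact: al_lin. Qed.

Lemma derive_form1_lee (al : form1 X) i x w : img i x ->
  (forall y, img i y -> scalar (al i y)) ->
  (forall v, differentiable (fun y => al i y v) x) ->
  'D_w (fun y => al i y (B i y)) x
    = 'D_w (fun y => al i y (B i x)) x + al i x ('D_w (B i) x).
Proof.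
move=> ix al_lin dal; apply: derive_contraction => //.
  exact: near_img_scalar.
exact: lee_differentiable.
Qed.

(** The function h of the overview; theta(B) = g(B, B) is the squared norm of the Lee form. *)
Definition lee_defect (i : chart X) (x : E) : R := th i x (B i x) - a^-1.

Lemma lee_defect_glue i j x : overlap i j x ->
  lee_defect i x = lee_defect j (transition i j x).
Proof.
move=> ijx; rewrite /lee_defect; congr (_ - _).
have [[_ B_glue] _] := B_lee; have [_ _ th_glue] := th_form.
by rewrite (B_glue _ _ _ ijx) -(th_glue _ _ _ ijx).
Qed.

Let sq_norm_differentiable i x :
  img i x -> differentiable (fun y => th i y (B i y)) x.
Proof.
move=> ix; apply: differentiable_contraction.
- by apply: near_img_scalar ix _ => y; exact: form1_scalar.
- by move=> v; exact: form1_differentiable.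
- exact: lee_differentiable.
Qed.

Lemma lee_defect_differentiable i x :
  img i x -> differentiable (lee_defect i) x.
Proof.
move=> ix; apply: (differentiableB (f := fun y => th i y (B i y)) (g := cst _)).
  exact: sq_norm_differentiable.
exact: differentiable_cst.
Qed.

(* Since [eta B = 0], [L_B eta = i_B d eta], which by [Omega_eq] is
   [lee_defect * eta]; since [B] is holomorphic, [L_B eta = J (L_B th)], which
   is [J d(th B)] because [th] is closed. *)
Lemma derive_lee_defect i x w :
  img i x -> 'D_w (lee_defect i) x = lee_defect i x * th i x w.
Proof.
move=> ix; have th_lin := form1_scalar th_form ix.
(* The second argument is [J0 w] because [eta] at [J0 w] is [th] at [w]. *)
have eta_eq := Omega_eq ix (B i x) (J0 w).
have th_diff v := form1_differentiable th_form v ix.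
rewrite [LHS]lee_dualJ// /wedge11 -/eta Jform_lee// in eta_eq.
have etaJ : eta i x (J0 w) = th i x w.
  by rewrite /eta /Jform /Jfield J0K scalar_formN// opprK.
(* Differentiate eta(B) = 0 along [J0 w]; holomorphy turns the derivative of [B] along [J0 w] into
   [J0] of that along [w]. *)
have d_etaB :
    0 = 'D_(J0 w) (fun y => eta i y (B i x)) x - th i x (- 'D_w (B i) x).
  have := derive_form1_lee (J0 w) ix (@Jform_scalar i)
    (fun v => Jform_differentiable v ix).
  rewrite (@near_derive_eq _ _ _ _ i _ (cst 0)) ?derive_cst//; last first.
    by move=> y iy; exact: Jform_lee.
  by rewrite /eta /Jform /Jfield derive_lee_J// J0K.
(* Closedness of [th] exchanges the directions [B] and [w]. *)
have d_etaJw : 'D_(B i x) (fun y => eta i y (J0 w)) x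
    = 'D_w (fun y => th i y (B i x)) x.
  have [_ _ /(_ i x ix w (B i x)) + _] := g_lck.
  rewrite /d1 => /eqP; rewrite subr_eq0 => /eqP ->.
  apply: (near_derive_eq _ ix) => y iy; rewrite /eta /Jform /Jfield J0K.
  by rewrite (scalar_formN (form1_scalar th_form iy)) opprK.
have d_f : 'D_w (lee_defect i) x
    = 'D_w (fun y => th i y (B i x)) x + th i x ('D_w (B i) x).
  rewrite -(derive_form1_lee w ix (@form1_scalar _ _ _ _ _ th_form i) th_diff).
  rewrite (deriveB (f := fun y => th i y (B i y)) (g := cst _)).
  - by rewrite derive_cst subr0.
  - exact/diff_derivable/sq_norm_differentiable.
  - exact: derivable_cst.
move: eta_eq; rewrite /d1 -/eta etaJ d_etaJw.
rewrite (scalar_formN th_lin) opprK in d_etaB.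
have -> : 'D_(J0 w) (fun y => eta i y (B i x)) x = - th i x ('D_w (B i) x).
  by apply/eqP; rewrite -addr_eq0 -d_etaB.
rewrite opprK -d_f /lee_defect => eta_eq.
have a0 : a != 0 by rewrite gt_eqF.
apply: (mulfI a0); rewrite mulrA mulrBr divff// mulrBl mul1r.
by rewrite [X in _ = _ - X]eta_eq; ring.
Qed.

(** The left side is (L_B Omega)(u, v) on constant fields. By Cartan, L_B Omega = i_B dOmega + d eta
    = theta(B) Omega - theta ∧ eta + d eta, and [Omega_eq] gives d eta = theta ∧ eta - Omega / a. *)
Lemma lie_fundamental_form i x u v : img i x ->
  'D_(B i x) (fun y => Om i y u v) x
    + Om i x ('D_u (B i) x) v + Om i x u ('D_v (B i) x)
  = lee_defect i x * Om i x u v.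
Proof.
move=> ix.
have Om_lin w y : img i y -> scalar (fun z => Om i y z w).
  move=> iy c z z'; rewrite /Om /fundamental_form /Jfield J0_linear.
  by rewrite (hermitian_bilin g_herm iy w).2.
have contract p q : 'D_p (fun y => eta i y q) x
    = 'D_p (fun y => Om i y (B i x) q) x + Om i x ('D_p (B i) x) q.
  rewrite -(derive_form1_lee (al := fun i y z => Om i y z q)) //.
  - by apply: (near_derive_eq _ ix) => y iy; rewrite lee_dualJ.
  - by move=> y; exact: Om_lin.
  - by move=> z; exact: (hermitian_differentiable g_herm).
have [_ _ _ /(_ i x ix (B i x) u v)] := g_lck.
rewrite /d2 /wedge12 -/Om !lee_dualJ// => dOm.
have := Omega_eq ix u v; rewrite /d1 /wedge11 -/eta -/Om !contract.
have -> : Om i x u ('D_v (B i) x) = - Om i x ('D_v (B i) x) u.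
  exact: fundamental_form_anti.
move: dOm => /(canRL (addrK _))/(canRL (subrK _)) ->.
rewrite /lee_defect => Om_eq; have a0 : a != 0 by rewrite gt_eqF.
apply: (mulfI a0).
have -> : a * ((th i x (B i x) - a^-1) * Om i x u v)
        = a * th i x (B i x) * Om i x u v - Om i x u v by field.
by rewrite [X in _ = _ - X]Om_eq; ring.
Qed.

(** As g(u, v) = Omega(-Ju, v) and L_B J = 0, the formula for L_B Omega passes to g. *)
Lemma lie_metric i x u v : img i x ->
  'D_(B i x) (fun y => g i y u v) x
    + g i x ('D_u (B i) x) v + g i x u ('D_v (B i) x)
  = lee_defect i x * g i x u v.
Proof.
move=> ix; have := lie_fundamental_form (J0 (- u)) v ix.
have JJN w : J0 (J0 (- w)) = w by rewrite J0K opprK.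
rewrite derive_lee_J// /Om /fundamental_form /Jfield.
have dB := lee_differentiable ix.
rewrite !JJN J0K (deriveE (- u) dB) linearN opprK -(deriveE u dB).
by [].
Qed.

(** For theta = g(B, .) one has 2 nabla theta = d theta + L_B g, the splitting into skew and
    symmetric parts. The first vanishes by closedness, the second by [lie_metric] with zero
    defect. *)
Lemma nabla_lee i x u v : img i x -> lee_defect i x = 0 ->
  nabla1 (christoffel g) th i x u v = 0.
Proof.
move=> ix h0; rewrite /nabla1.
rewrite -(lee_dual _ ix) (hermitian_sym g_herm _ _ ix) christoffelE//.
have contract p q : 'D_p (fun y => th i y q) x
    = 'D_p (fun y => g i y (B i x) q) x + g i x ('D_p (B i) x) q.
  rewrite -(derive_form1_lee (al := fun i y z => g i y z q)) //.
  - by apply: (near_derive_eq _ ix) => y iy; rewrite lee_dual.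
  - by move=> y iy; have [] := hermitian_bilin g_herm iy q.
  - by move=> z; exact: (hermitian_differentiable g_herm).
have [_ _ /(_ i x ix u v) + _] := g_lck; rewrite /d1 !contract.
have := lie_metric u v ix; rewrite h0 mul0r /koszul.
have sym p q : 'D_p (fun y => g i y (B i x) q) x = 'D_p (fun y => g i y q (B i x)) x.
  by apply: (near_derive_eq _ ix) => y iy; exact: (hermitian_sym g_herm).
rewrite !sym (hermitian_sym g_herm u _ ix).
by move=> killing closed; lra.
Qed.

End LeeField.

(** * The Vaisman property *)

Theorem proposition0p6 (R : realType) (n : nat) (M : topologicalType)
  (X : complexManifold R n M)
  (M_connected : connected [set: M])
  (not_kahler : ~ kahler_type X)
  (g : tensor2 X) (th : form1 X)
  (g_lck : lck_metric g th)
  (a : R) (a_gt0 : 0 < a)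
  (Omega_eq : forall (i : chart X) x, img i x -> forall u v,
     fundamental_form g i x u v
       = - a * d1 (Jform th) i x u v
         + wedge11 th (fun j y w => a * Jform th j y w) i x u v)
  (B : vfield X) (B_lee : lee_field g th B)
  (B_hol : real_holomorphic B) :
  vaisman g th.
Proof.
split=> //; exists (christoffel g).
have [g_herm th_form _ _] := g_lck.
split; first exact: levi_civita_christoffel.
have h_glue := lee_defect_glue a g_lck B_lee.
have dh := lee_defect_differentiable a g_lck B_lee.
have Dh := derive_lee_defect g_lck a_gt0 Omega_eq B_lee B_hol.
have [h0|h_neq0] := log_derivative_dichotomy th_form h_glue dh
  (fun i x v => @Dh i x v) M_connected.
  move=> i x ix u v.
  exact: (nabla_lee g_lck a_gt0 Omega_eq B_lee B_hol u v ix (h0 i x ix)).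
case: not_kahler.
exact: (inv_norm_kahler g_lck h_neq0 h_glue dh (fun i x v => @Dh i x v)).
Qed.
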